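(* Let $c_i,h_i,\sigma_i\in\mathbb R$ with $\sigma_i\ne0$ and $\lambda_i>0$, $i\in\{1,2\}$, be constants. For $\lambda_i^*>0$, $\sigma_i^*\in\mathbb R$, $i\in\{1,2\}$, put $$b_i=\lambda_i-\lambda_i^*+\lambda_i^*\ln(\lambda_i^*/\lambda_i)+(\sigma_i^* )^2/2,\quad i\in\{1,2\},\qquad B=\frac{\lambda_2^*b_1+\lambda_1^*b_2}{\lambda_1^*+\lambda_2^*}.$$ Consider, with respect to the unknowns $\lambda_1^*,\lambda_2^*>0$ and $\sigma_1^*,\sigma_2^*\in\mathbb R$ subject to the martingale condition $$c_1+\lambda_1^*h_1+\sigma_1^*\sigma_1=0,\qquad c_2+\lambda_2^*h_2+\sigma_2^*\sigma_2=0,$$ the two optimisation problems: (short-term) $b_1\to\min$ and $b_2\to\min$ (simultaneously); (long-term) $B\to\min$. Then each of the two problems has a solution, and this solution is unique.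
   Context: The problems arise from a two-state Markov-modulated jump-diffusion process with constant drifts $c_i$, jump sizes $h_i$, diffusion coefficients $\sigma_i$ and switching intensities $\lambda_i$ under $\mathbb P$. The numbers $\lambda_i^*$ are the switching intensities under an equivalent measure $\mathbb Q$ and $\sigma_i^*$ are the Girsanov drift parameters of the Brownian part. The constraint says that $\mathbb Q$ is a martingale measure. The solution of the short-term (resp. long-term) problem defines the short-term (resp. long-term) minimal entropy martingale measure. The claim itself only involves the finite-dimensional optimisation problems written out in it. *)

(* Defs.v *)
From Stdlib Require Import Reals.
Open Scope R_scope.

(* Candidate parameters of an equivalent measure: switching intensities
   [ls1], [ls2] and Girsanov drifts [ss1], [ss2]. *)
Record unknowns : Type := Unknowns { ls1 : R; ls2 : R; ss1 : R; ss2 : R }.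

Definition admissible (c1 c2 h1 h2 sigma1 sigma2 : R) (q : unknowns) : Prop :=
  0 < ls1 q /\ 0 < ls2 q /\
  c1 + ls1 q * h1 + ss1 q * sigma1 = 0 /\
  c2 + ls2 q * h2 + ss2 q * sigma2 = 0.

Definition b (lambda ls ss : R) : R :=
  lambda - ls + ls * ln (ls / lambda) + ss ^ 2 / 2.

Definition b1 (lambda1 : R) (q : unknowns) : R := b lambda1 (ls1 q) (ss1 q).

Definition b2 (lambda2 : R) (q : unknowns) : R := b lambda2 (ls2 q) (ss2 q).

(* The weight of [b1] is proportional to [ls2], and conversely. *)
Definition B (lambda1 lambda2 : R) (q : unknowns) : R :=
  (ls2 q * b1 lambda1 q + ls1 q * b2 lambda2 q) / (ls1 q + ls2 q).

Definition is_minimizer (S : unknowns -> Prop) (f : unknowns -> R)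
    (q : unknowns) : Prop :=
  S q /\ forall q', S q' -> f q <= f q'.

(* A single admissible point has to minimise both [b1] and [b2]. *)
Definition short_term_solution
    (c1 c2 h1 h2 sigma1 sigma2 lambda1 lambda2 : R) (q : unknowns) : Prop :=
  is_minimizer (admissible c1 c2 h1 h2 sigma1 sigma2) (b1 lambda1) q /\
  is_minimizer (admissible c1 c2 h1 h2 sigma1 sigma2) (b2 lambda2) q.

Definition long_term_solution
    (c1 c2 h1 h2 sigma1 sigma2 lambda1 lambda2 : R) (q : unknowns) : Prop :=
  is_minimizer (admissible c1 c2 h1 h2 sigma1 sigma2) (B lambda1 lambda2) q.

(* Main.v *)
Require Import Defs.
From Stdlib Require Import Reals.
From Stdlib Require Import Lra Ranalysis5.
From Coquelicot Require Import Coquelicot.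
Open Scope R_scope.

(** The martingale condition determines each Girsanov drift from its intensity,
    so everything is about one function per state,
    [f_i x = b_i] evaluated at intensity [x] and drift [- (c_i + x h_i) / sigma_i].
    It is strictly convex on the half-line [x > 0]: it is the relative-entropy
    term [x ln x] plus a quadratic polynomial with nonnegative leading
    coefficient ([entropy_above_tangent]).

    Short-term problem.  The slope [f_i'] is [ln] plus an affine nondecreasing
    function, hence has a zero, and a strictly convex function lies strictly
    above its horizontal tangent.  The two states do not interact, so the pair
    of the two minimisers is the one simultaneous minimiser.

    Long-term problem.  [B] couples the two intensities through its weights, and
    a pair of tangents certifies its minimum.  Suppose that the tangent to [f1] at [x] and
    the tangent to [f2] at [y] have the same intercept [m] at [0] and opposite
    slopes [s] and [- s].  Then [f1 z >= m + s z] and [f2 w >= m - s w], and in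
    the combination [w f1 z + z f2 w] the terms in [s] cancel:
    [w f1 z + z f2 w >= m (z + w)], that is [B >= m], with equality only at
    [z = x], [w = y] ([long_term_strict_min]).

    Such tangents exist ([balanced_tangents]).  The intercept
    [f_i x - x f_i' x] equals [a_i - x - k_i x ^ 2], with
    [a_i = lambda_i + c_i ^ 2 / (2 sigma_i ^ 2)] and
    [k_i = h_i ^ 2 / (2 sigma_i ^ 2)], so equality of intercepts can be solved
    for one intensity as a continuous function of the other.  Along this curve
    the sum of the two slopes changes sign, because the logarithm of the
    independent intensity tends to minus infinity at one end and to infinity at
    the other, and the remaining terms are bounded in the direction that matters
    ([balanced_system_solvable]). *)

(** * Zeros of perturbations of the logarithm *)

(** [ln] runs from minus to plus infinity, so a perturbation that is bounded
    above near [0] and below near infinity cannot remove its zero. *)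
Lemma ln_perturbation_zero (g : R -> R) (M N : R) :
  (forall x, 0 < x -> ex_derive g x) ->
  (forall x, 0 < x <= 1 -> g x <= M) ->
  (forall x, 1 <= x -> N <= g x) ->
  exists x, 0 < x /\ ln x + g x = 0.
Proof.
  intros Hd HM HN.
  assert (Hlt : forall t, 0 < t -> exp (- t) < 1 < exp t).
  { intros t Ht; rewrite <- exp_0; split; apply exp_increasing; lra. }
  pose proof (Rabs_pos M) as HM0. pose proof (Rabs_pos N) as HN0.
  destruct (Hlt (Rabs M + 1)) as [Hlo _]; [lra|].
  destruct (Hlt (Rabs N + 1)) as [_ Hhi]; [lra|].
  pose proof (exp_pos (- (Rabs M + 1))) as Hpos.
  (* The endpoints are chosen so that [ln] is [- |M| - 1] and [|N| + 1], which
     outweighs the bounds on [g]; they lie on the two sides of [1]. *)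
  destruct (IVT_interv (fun x => ln x + g x)
              (exp (- (Rabs M + 1))) (exp (Rabs N + 1))) as [x [Hx Hx0]].
  - intros x Hx; apply derivable_continuous_pt, ex_derive_Reals_0.
    apply (@ex_derive_plus R_AbsRing R_NormedModule).
    + auto_derive; lra.
    + apply Hd; lra.
  - lra.
  - rewrite ln_exp. pose proof (HM _ (conj Hpos (Rlt_le _ _ Hlo))).
    pose proof (Rle_abs M). lra.
  - rewrite ln_exp. pose proof (HN _ (Rlt_le _ _ Hhi)).
    pose proof (Rle_abs (- N)) as HA. rewrite Rabs_Ropp in HA. lra.
  - exists x; split; [lra | exact Hx0].
Qed.

(** The nonnegative root of [y + k y ^ 2 = r], written with the square root in
    the denominator so that the formula also covers [k = 0]. *)
Definition quadratic_root (k r : R) : R := 2 * r / (1 + sqrt (1 + 4 * k * r)).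

Lemma quadratic_rootP (k r : R) : 0 <= k -> 0 < r ->
  0 < quadratic_root k r /\ quadratic_root k r + k * quadratic_root k r ^ 2 = r.
Proof.
  intros Hk Hr. unfold quadratic_root.
  assert (Hkr : 0 <= k * r) by (apply Rmult_le_pos; lra).
  assert (Hs : sqrt (1 + 4 * k * r) * sqrt (1 + 4 * k * r) = 1 + 4 * k * r)
    by (apply sqrt_sqrt; lra).
  pose proof (sqrt_pos (1 + 4 * k * r)) as Hs0.
  set (s := sqrt (1 + 4 * k * r)) in *.
  split.
  - apply Rdiv_lt_0_compat; lra.
  - replace (2 * r / (1 + s) + k * (2 * r / (1 + s)) ^ 2)
      with (r * (2 * (1 + s) + 4 * k * r) / (1 + s) ^ 2) by (field; lra).
    replace (4 * k * r) with (s * s - 1) by lra.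
    field; lra.
Qed.

(** The first equation gives [y] as a function of [x] that is bounded above for
    [x <= 1] and bounded away from [0] for [x >= 1].  So in the second equation
    everything but [ln x] is a perturbation of the kind treated in
    [ln_perturbation_zero]. *)
Lemma balanced_system_solvable (k1 k2 d C : R) :
  0 <= k1 -> 0 <= k2 -> 0 <= d ->
  exists x y, 0 < x /\ 0 < y /\
    y + k2 * y ^ 2 = x + k1 * x ^ 2 + d /\
    ln x + 2 * k1 * x + (ln y + 2 * k2 * y) = C.
Proof.
  intros Hk1 Hk2 Hd.
  set (r := fun x => x + k1 * x ^ 2 + d).
  assert (Hr : forall x, 0 < x -> x <= r x).
  { intros x Hx; unfold r.
    pose proof (Rmult_le_pos _ _ Hk1 (pow2_ge_0 x)). lra. }
  assert (HY : forall x, 0 < x ->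
    0 < quadratic_root k2 (r x) /\
    quadratic_root k2 (r x) + k2 * quadratic_root k2 (r x) ^ 2 = r x).
  { intros x Hx; apply quadratic_rootP; [exact Hk2|].
    specialize (Hr x Hx); lra. }
  destruct (ln_perturbation_zero
    (fun x => 2 * k1 * x
       + (ln (quadratic_root k2 (r x)) + 2 * k2 * quadratic_root k2 (r x)) - C)
    (2 * k1 + (ln (1 + k1 + d) + 2 * k2 * (1 + k1 + d)) - C)
    (ln (/ (1 + k2)) - C)) as [x [Hx Heq]].
  - intros x Hx. destruct (HY x Hx) as [Hy _]. specialize (Hr x Hx).
    unfold r, quadratic_root in *.
    assert (0 <= k2 * (x + k1 * x ^ 2 + d)) by (apply Rmult_le_pos; lra).
    pose proof (sqrt_pos (1 + 4 * k2 * (x + k1 * x ^ 2 + d))).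
    auto_derive. simpl in *. repeat split; lra.
  - intros x [Hx Hx1]. destruct (HY x Hx) as [Hy HyE].
    set (y := quadratic_root k2 (r x)) in *.
    assert (Hle : y <= 1 + k1 + d).
    { apply Rle_trans with (r x).
      - pose proof (Rmult_le_pos _ _ Hk2 (pow2_ge_0 y)). lra.
      - unfold r. assert (x ^ 2 <= 1) by nra. nra. }
    assert (ln y <= ln (1 + k1 + d)) by (apply ln_le; lra).
    nra.
  - intros x Hx1. assert (Hx : 0 < x) by lra.
    destruct (HY x Hx) as [Hy HyE]. specialize (Hr x Hx).
    set (y := quadratic_root k2 (r x)) in *.
    assert (Hi : 0 < / (1 + k2)) by (apply Rinv_0_lt_compat; lra).
    (* Below [1 / (1 + k2) <= 1] the left side [y + k2 y ^ 2] is less than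
       [y (1 + k2) < 1], whereas it equals [r x >= 1]. *)
    assert (Hge : / (1 + k2) <= y).
    { apply Rnot_lt_le; intros Hlt.
      assert (Hm : / (1 + k2) * (1 + k2) = 1) by (field; lra).
      assert (y * (1 + k2) < 1) by nra.
      assert (y < 1) by nra. nra. }
    assert (ln (/ (1 + k2)) <= ln y) by (apply ln_le; lra).
    nra.
  - exists x, (quadratic_root k2 (r x)).
    destruct (HY x Hx) as [Hy HyE].
    repeat split; [exact Hx | exact Hy | exact HyE | lra].
Qed.

(** * The entropy of one state along the martingale condition *)

Definition martingale_drift (c h s x : R) : R := - (c + x * h) / s.

Definition entropy (c h s l x : R) : R := b l x (martingale_drift c h s x).

(** The derivative of [entropy] in [x]. *)
Definition slope (c h s l x : R) : R := ln (x / l) + h * (c + x * h) / s ^ 2.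

Lemma ln_lt_sub1 (t : R) : 0 < t -> t <> 1 -> ln t < t - 1.
Proof.
  intros Ht Hne.
  assert (Hln : ln t <> 0).
  { intros H0. apply Hne, ln_inv; [exact Ht | lra | now rewrite ln_1]. }
  pose proof (exp_ineq1 _ Hln) as H. rewrite exp_ln in H; lra.
Qed.

(** The gap between the entropy and its tangent is
    [z ln (z / x) - z + x + (h (z - x) / s) ^ 2 / 2], and its logarithmic part
    is positive for [z <> x] because [ln (x / z) < x / z - 1]. *)
Lemma entropy_above_tangent (c h s l x z : R) :
  s <> 0 -> 0 < l -> 0 < x -> 0 < z -> z <> x ->
  entropy c h s l x + slope c h s l x * (z - x) < entropy c h s l z.
Proof.
  intros Hs Hl Hx Hz Hne.
  assert (Hlog : ln (x / z) < x / z - 1).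
  { apply ln_lt_sub1; [now apply Rdiv_lt_0_compat|].
    intros H1. apply Hne. replace x with (x / z * z) by (field; lra).
    rewrite H1; ring. }
  apply (Rmult_lt_compat_l z) in Hlog; [|exact Hz].
  replace (z * (x / z - 1)) with (x - z) in Hlog by (field; lra).
  rewrite ln_div in Hlog by assumption.
  pose proof (pow2_ge_0 (h * (z - x) / s)) as Hsq.
  assert (E : entropy c h s l z
              - (entropy c h s l x + slope c h s l x * (z - x))
            = x - z - z * (ln x - ln z) + (h * (z - x) / s) ^ 2 / 2).
  { unfold entropy, slope, b, martingale_drift.
    rewrite !ln_div by assumption. field; exact Hs. }
  lra.
Qed.

Lemma entropy_above_tangent_le (c h s l x z : R) :
  s <> 0 -> 0 < l -> 0 < x -> 0 < z ->
  entropy c h s l x + slope c h s l x * (z - x) <= entropy c h s l z.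
Proof.
  intros Hs Hl Hx Hz. destruct (Req_dec z x) as [-> | Hne].
  - lra.
  - apply Rlt_le, entropy_above_tangent; assumption.
Qed.

(** The logarithmic term cancels, which is why equality of two
    intercepts is a polynomial equation. *)
Lemma tangent_intercept (c h s l x : R) : s <> 0 ->
  entropy c h s l x - slope c h s l x * x
  = l + c ^ 2 / (2 * s ^ 2) - (x + h ^ 2 / (2 * s ^ 2) * x ^ 2).
Proof.
  intros Hs. unfold entropy, slope, b, martingale_drift. field; exact Hs.
Qed.

Lemma half_square_ratio_nonneg (h s : R) : s <> 0 -> 0 <= h ^ 2 / (2 * s ^ 2).
Proof.
  intros Hs. replace (h ^ 2 / (2 * s ^ 2)) with ((h / s) ^ 2 / 2)
    by (field; exact Hs).
  pose proof (pow2_ge_0 (h / s)). lra.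
Qed.

Lemma slope_eq (c h s l x : R) : s <> 0 -> 0 < l -> 0 < x ->
  slope c h s l x
  = ln x + 2 * (h ^ 2 / (2 * s ^ 2)) * x + (h * c / s ^ 2 - ln l).
Proof.
  intros Hs Hl Hx. unfold slope. rewrite ln_div by assumption. field; exact Hs.
Qed.

Lemma slope_zero (c h s l : R) : s <> 0 -> 0 < l ->
  exists x, 0 < x /\ slope c h s l x = 0.
Proof.
  intros Hs Hl.
  pose proof (half_square_ratio_nonneg h s Hs) as Hk.
  assert (E := fun x => slope_eq c h s l x Hs Hl).
  set (k := h ^ 2 / (2 * s ^ 2)) in *.
  set (e := h * c / s ^ 2 - ln l) in *.
  destruct (ln_perturbation_zero (fun x => 2 * k * x + e) (2 * k + e) e)
    as [x [Hx Hx0]].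
  - intros x _; auto_derive; exact I.
  - intros x Hx; nra.
  - intros x Hx; nra.
  - exists x; split; [exact Hx|]. rewrite E by exact Hx. lra.
Qed.

(** The tangent at the zero of the slope is horizontal, and the graph lies
    strictly above it. *)
Lemma entropy_strict_min (c h s l : R) : s <> 0 -> 0 < l ->
  exists x, 0 < x /\
    forall z, 0 < z -> z <> x -> entropy c h s l x < entropy c h s l z.
Proof.
  intros Hs Hl. destruct (slope_zero c h s l Hs Hl) as [x [Hx Hx0]].
  exists x; split; [exact Hx|]. intros z Hz Hne.
  pose proof (entropy_above_tangent c h s l x z Hs Hl Hx Hz Hne) as H.
  rewrite Hx0 in H. lra.
Qed.

(** * Tangents that certify the long-term minimum *)

(** The dependent intensity belongs to the state with the larger [a_i], so that
    the equation of intercepts asks [y + k y ^ 2] to take a positive value for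
    every positive intensity of the other state; this is why the order of
    [a1] and [a2] decides which state is parametrised by which. *)
Lemma balanced_tangents (c1 c2 h1 h2 s1 s2 l1 l2 : R) :
  s1 <> 0 -> s2 <> 0 -> 0 < l1 -> 0 < l2 ->
  exists x y, 0 < x /\ 0 < y /\
    entropy c1 h1 s1 l1 x - slope c1 h1 s1 l1 x * x
    = entropy c2 h2 s2 l2 y - slope c2 h2 s2 l2 y * y /\
    slope c1 h1 s1 l1 x + slope c2 h2 s2 l2 y = 0.
Proof.
  intros Hs1 Hs2 Hl1 Hl2.
  pose proof (half_square_ratio_nonneg h1 s1 Hs1) as Hk1.
  pose proof (half_square_ratio_nonneg h2 s2 Hs2) as Hk2.
  set (a1 := l1 + c1 ^ 2 / (2 * s1 ^ 2)).
  set (a2 := l2 + c2 ^ 2 / (2 * s2 ^ 2)).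
  set (C := - (h1 * c1 / s1 ^ 2 - ln l1) - (h2 * c2 / s2 ^ 2 - ln l2)).
  destruct (Rle_dec a1 a2) as [Ha | Ha].
  - destruct (balanced_system_solvable _ _ (a2 - a1) C Hk1 Hk2)
      as (x & y & Hx & Hy & Hint & Hslope); [lra|].
    exists x, y. rewrite !tangent_intercept, !slope_eq by assumption.
    fold a1 a2. repeat split; [exact Hx | exact Hy | lra | unfold C in *; lra].
  - destruct (balanced_system_solvable _ _ (a1 - a2) C Hk2 Hk1)
      as (y & x & Hy & Hx & Hint & Hslope); [lra|].
    exists x, y. rewrite !tangent_intercept, !slope_eq by assumption.
    fold a1 a2. repeat split; [exact Hx | exact Hy | lra | unfold C in *; lra].
Qed.

Definition long_term_cost (c1 c2 h1 h2 s1 s2 l1 l2 z w : R) : R :=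
  (w * entropy c1 h1 s1 l1 z + z * entropy c2 h2 s2 l2 w) / (z + w).

(** Balanced tangents have intercept [m] and slopes [p], [- p]; the weights [w]
    and [z] make the contributions [w (p z)] and [z (- p w)] of the slopes
    cancel, so the tangents bound the cost below by [m] everywhere. *)
Lemma long_term_strict_min (c1 c2 h1 h2 s1 s2 l1 l2 : R) :
  s1 <> 0 -> s2 <> 0 -> 0 < l1 -> 0 < l2 ->
  exists x y, 0 < x /\ 0 < y /\
    forall z w, 0 < z -> 0 < w -> (z <> x \/ w <> y) ->
      long_term_cost c1 c2 h1 h2 s1 s2 l1 l2 x y
      < long_term_cost c1 c2 h1 h2 s1 s2 l1 l2 z w.
Proof.
  intros Hs1 Hs2 Hl1 Hl2.
  destruct (balanced_tangents c1 c2 h1 h2 s1 s2 l1 l2 Hs1 Hs2 Hl1 Hl2)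
    as (x & y & Hx & Hy & Hint & Hslope).
  exists x, y; split; [exact Hx|]; split; [exact Hy|].
  intros z w Hz Hw Hne. unfold long_term_cost.
  pose proof (entropy_above_tangent_le c1 h1 s1 l1 x z Hs1 Hl1 Hx Hz) as H1.
  pose proof (entropy_above_tangent_le c2 h2 s2 l2 y w Hs2 Hl2 Hy Hw) as H2.
  assert (Hstrict :
    entropy c1 h1 s1 l1 x + slope c1 h1 s1 l1 x * (z - x) < entropy c1 h1 s1 l1 z
    \/ entropy c2 h2 s2 l2 y + slope c2 h2 s2 l2 y * (w - y) < entropy c2 h2 s2 l2 w)
    by (destruct Hne; [left | right]; apply entropy_above_tangent; assumption).
  revert H1 H2 Hstrict Hint Hslope.
  generalize (entropy c1 h1 s1 l1 x) (entropy c2 h2 s2 l2 y)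
    (entropy c1 h1 s1 l1 z) (entropy c2 h2 s2 l2 w)
    (slope c1 h1 s1 l1 x) (slope c2 h2 s2 l2 y).
  intros fx fy fz fw p q H1 H2 Hstrict Hint Hslope.
  set (m := fx - p * x) in *.
  assert (Hq : q = - p) by lra. subst q.
  assert (Hfx : fx = m + p * x) by (unfold m; ring).
  assert (Hfy : fy = m - p * y) by lra.
  clearbody m. subst fx fy.
  replace ((y * (m + p * x) + x * (m - p * y)) / (x + y)) with m
    by (field; lra).
  apply Rmult_lt_reg_r with (z + w); [lra|].
  replace ((w * fz + z * fw) / (z + w) * (z + w)) with (w * fz + z * fw)
    by (field; lra).
  assert (G1 : 0 <= w * (fz - (m + p * z))) by (apply Rmult_le_pos; lra).
  assert (G2 : 0 <= z * (fw - (m - p * w))) by (apply Rmult_le_pos; lra).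
  destruct Hstrict.
  - assert (0 < w * (fz - (m + p * z))) by (apply Rmult_lt_0_compat; lra). lra.
  - assert (0 < z * (fw - (m - p * w))) by (apply Rmult_lt_0_compat; lra). lra.
Qed.

(** * Candidate measures and their intensities *)

Definition martingale_measure (c1 c2 h1 h2 s1 s2 x y : R) : unknowns :=
  Unknowns x y (martingale_drift c1 h1 s1 x) (martingale_drift c2 h2 s2 y).

Lemma martingale_measure_admissible (c1 c2 h1 h2 s1 s2 x y : R) :
  s1 <> 0 -> s2 <> 0 -> 0 < x -> 0 < y ->
  admissible c1 c2 h1 h2 s1 s2 (martingale_measure c1 c2 h1 h2 s1 s2 x y).
Proof.
  intros Hs1 Hs2 Hx Hy. unfold admissible, martingale_drift; simpl.
  unfold martingale_drift.
  repeat split; [exact Hx | exact Hy | field; assumption | field; assumption].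
Qed.

(** The martingale condition leaves only the intensities free. *)
Lemma admissible_martingale_measure (c1 c2 h1 h2 s1 s2 : R) (q : unknowns) :
  s1 <> 0 -> s2 <> 0 -> admissible c1 c2 h1 h2 s1 s2 q ->
  exists x y, 0 < x /\ 0 < y /\ q = martingale_measure c1 c2 h1 h2 s1 s2 x y.
Proof.
  intros Hs1 Hs2. destruct q as [x y u v]; unfold admissible; simpl.
  intros (Hx & Hy & Hu & Hv). exists x, y.
  split; [exact Hx|]; split; [exact Hy|].
  unfold martingale_measure, martingale_drift; f_equal.
  - apply Rmult_eq_reg_r with s1; [|exact Hs1].
    replace (- (c1 + x * h1) / s1 * s1) with (- (c1 + x * h1)) by (field; exact Hs1).
    lra.
  - apply Rmult_eq_reg_r with s2; [|exact Hs2].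
    replace (- (c2 + y * h2) / s2 * s2) with (- (c2 + y * h2)) by (field; exact Hs2).
    lra.
Qed.

Theorem theorem5p4 (c1 c2 h1 h2 sigma1 sigma2 lambda1 lambda2 : R)
    (hsigma1 : sigma1 <> 0) (hsigma2 : sigma2 <> 0)
    (hlambda1 : 0 < lambda1) (hlambda2 : 0 < lambda2) :
  (exists! q : unknowns,
     short_term_solution c1 c2 h1 h2 sigma1 sigma2 lambda1 lambda2 q) /\
  (exists! q : unknowns,
     long_term_solution c1 c2 h1 h2 sigma1 sigma2 lambda1 lambda2 q).
Proof.
  pose proof (fun x y => martingale_measure_admissible c1 c2 h1 h2 _ _ x y
                           hsigma1 hsigma2) as Hadm.
  pose proof (fun q => admissible_martingale_measure c1 c2 h1 h2 _ _ q
                         hsigma1 hsigma2) as Hform.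
  split.
  - destruct (entropy_strict_min c1 h1 _ _ hsigma1 hlambda1) as [x [Hx Hminx]].
    destruct (entropy_strict_min c2 h2 _ _ hsigma2 hlambda2) as [y [Hy Hminy]].
    exists (martingale_measure c1 c2 h1 h2 sigma1 sigma2 x y).
    split.
    + split; (split; [now apply Hadm|]); intros q' Hq';
        destruct (Hform q' Hq') as (z & w & Hz & Hw & ->).
      * change (entropy c1 h1 sigma1 lambda1 x <= entropy c1 h1 sigma1 lambda1 z).
        destruct (Req_dec z x) as [-> | Hne]; [lra | now apply Rlt_le, Hminx].
      * change (entropy c2 h2 sigma2 lambda2 y <= entropy c2 h2 sigma2 lambda2 w).
        destruct (Req_dec w y) as [-> | Hne]; [lra | now apply Rlt_le, Hminy].
    + intros q' [[Hq' Hb1] [_ Hb2]].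
      destruct (Hform q' Hq') as (z & w & Hz & Hw & ->).
      specialize (Hb1 _ (Hadm x y Hx Hy)). specialize (Hb2 _ (Hadm x y Hx Hy)).
      change (entropy c1 h1 sigma1 lambda1 z <= entropy c1 h1 sigma1 lambda1 x) in Hb1.
      change (entropy c2 h2 sigma2 lambda2 w <= entropy c2 h2 sigma2 lambda2 y) in Hb2.
      destruct (Req_dec z x) as [-> | Hne]; [|specialize (Hminx z Hz Hne); lra].
      destruct (Req_dec w y) as [-> | Hne]; [|specialize (Hminy w Hw Hne); lra].
      reflexivity.
  - destruct (long_term_strict_min c1 c2 h1 h2 _ _ _ _
                hsigma1 hsigma2 hlambda1 hlambda2) as (x & y & Hx & Hy & Hmin).
    exists (martingale_measure c1 c2 h1 h2 sigma1 sigma2 x y).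
    split.
    + split; [now apply Hadm|]; intros q' Hq'.
      destruct (Hform q' Hq') as (z & w & Hz & Hw & ->).
      change (long_term_cost c1 c2 h1 h2 sigma1 sigma2 lambda1 lambda2 x y
              <= long_term_cost c1 c2 h1 h2 sigma1 sigma2 lambda1 lambda2 z w).
      destruct (Req_dec z x) as [-> | Hne]; [|apply Rlt_le, Hmin; auto].
      destruct (Req_dec w y) as [-> | Hne]; [lra | apply Rlt_le, Hmin; auto].
    + intros q' [Hq' HB].
      destruct (Hform q' Hq') as (z & w & Hz & Hw & ->).
      specialize (HB _ (Hadm x y Hx Hy)).
      change (long_term_cost c1 c2 h1 h2 sigma1 sigma2 lambda1 lambda2 z w
              <= long_term_cost c1 c2 h1 h2 sigma1 sigma2 lambda1 lambda2 x y) in HB.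
      destruct (Req_dec z x) as [-> | Hne];
        [|specialize (Hmin z w Hz Hw (or_introl Hne)); lra].
      destruct (Req_dec w y) as [-> | Hne];
        [|specialize (Hmin x w Hz Hw (or_intror Hne)); lra].
      reflexivity.
Qed.
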